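(* Let $P$ be a $2n$-dimensional symplectic space over a field $\mathbb{K}$, let $G\subset P$ be a subspace, and let $S=G\cap G^\bot$. Let the integers $k,g$ be defined by $\dim G=n-k+g$ and $\dim S=n-k-g$. Let $[n]=M\sqcup M^c$ be a partition, with corresponding subspaces $\alpha\subset P$ (for $M$) and $\alpha^\bot\subset P$ (for $M^c$), and put $$g(M)=\dim\big(((S^\bot\cap\alpha)+G)/G\big),\qquad g_{\mathrm{bare}}(M^c)=\dim\big(((G^\bot\cap\alpha^\bot)+S)/S\big).$$ Then $$g_{\mathrm{bare}}(M^c)+g(M)=2k.$$
   Context: A symplectic space is a finite-dimensional vector space with a nondegenerate alternating bilinear form; ${}^\bot$ is the orthogonal subspace with respect to this form. $[n]=\{1,\dots,n\}$. The partition $[n]=M\sqcup M^c$ enters only through a subspace $\alpha\subset P$ and its orthogonal complement $\alpha^\bot$; $\alpha$ may be any subspace of $P$. In the coding interpretation $P$ is the reduced Pauli group on $n$ qubits (an orthogonal direct sum of $n$ symplectic planes, one for each $j\in[n]$), $\alpha$ is the sum of the planes with index in $M$ and $\alpha^\bot$ the sum of those with index in $M^c$; $G$ is the gauge group of a subsystem code, $S$ its stabilizer group. One has $S^\bot=G^\bot+G$. *)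

(* Defs.v *)
From HB Require Import structures.
From mathcomp Require Import all_boot all_order all_algebra.

Set Implicit Arguments.
Unset Strict Implicit.
Unset Printing Implicit Defensive.

Import GRing.Theory.
Local Open Scope ring_scope.
Local Open Scope quotient_scope.

(* The quotient of a vector space by a subspace W, whose elements are the     *)
(* classes of the relation u - v \in W. MathComp only equips it with its      *)
(* Zmodule structure (Quotient.quot), to which the scaling is added here.     *)
Section QuotientSpace.
Variables (K : fieldType) (vT : vectType K) (W : {vspace vT}).

Definition quotv := @Quotient.quot vT W.

HB.instance Definition _ := ZmodQuotient.on quotv.

Lemma quotv_eq (u v : vT) : (\pi_quotv u == \pi_quotv v) = (u - v \in W).
Proof. by rewrite -[LHS]/(u == v %[mod quotv]) -Quotient.idealrBE. Qed.

Lemma repr_quotvB (u : vT) : repr (\pi_quotv u) - u \in W.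
Proof. by rewrite -quotv_eq reprK. Qed.

Definition quotv_scale (a : K) (x : quotv) : quotv := \pi_quotv (a *: repr x).

Lemma quotv_scaleE a u : quotv_scale a (\pi_quotv u) = \pi_quotv (a *: u).
Proof. by apply/eqP; rewrite quotv_eq -scalerBr memvZ // repr_quotvB. Qed.

Lemma quotv_piD (u v : vT) :
  \pi_quotv (u + v) = \pi_quotv u + \pi_quotv v :> quotv.
Proof. by rewrite !piE. Qed.

Lemma quotv_scaleA a b x :
  quotv_scale a (quotv_scale b x) = quotv_scale (a * b) x.
Proof. by elim/quotW: x => u; rewrite (quotv_scaleE b) !quotv_scaleE scalerA. Qed.

Lemma quotv_scale1 : left_id 1 quotv_scale.
Proof. by elim/quotW => u; rewrite quotv_scaleE scale1r. Qed.

Lemma quotv_scaleDr : right_distributive quotv_scale +%R.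
Proof.
move=> a; elim/quotW => u; elim/quotW => v.
by rewrite -quotv_piD !quotv_scaleE -quotv_piD scalerDr.
Qed.

Lemma quotv_scaleDl x : {morph quotv_scale^~ x : a b / a + b}.
Proof.
by elim/quotW: x => u a b /=; rewrite !quotv_scaleE -quotv_piD scalerDl.
Qed.

HB.instance Definition _ := GRing.Zmodule_isLmodule.Build K quotv
  quotv_scaleA quotv_scale1 quotv_scaleDr quotv_scaleDl.

Lemma quotv_pi_linear : linear (\pi_quotv : vT -> quotv).
Proof. by move=> a u v; rewrite quotv_piD -quotv_scaleE. Qed.

(* Finite dimension: quotv is isomorphic to the complement W^C.               *)
Let toC (u : vT) : subvs_of W^C := vsproj W^C (daddv_pi W^C W u).

Let capCW : (W^C :&: W = 0)%VS. Proof. by rewrite capvC capv_compl. Qed.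

Let toC_eq (u v : vT) : (toC u == toC v) = (u - v \in W).
Proof.
rewrite -subr_eq0 -!linearB -val_eqE /= vsprojK ?memv_pi //.
have Duv := @daddv_pi_add _ _ _ _ (u - v) capCW.
rewrite addvC addv_complf memvf in Duv; move/(_ isT): Duv => Duv.
apply/eqP/idP => [pi0 | Wuv]; first by rewrite -Duv pi0 add0r memv_pi.
have piW: daddv_pi W^C W (u - v) \in W.
  by rewrite -[X in X \in W](addrK (daddv_pi W W^C (u - v))) Duv rpredB ?memv_pi.
by apply/eqP; rewrite -memv0 -capCW memv_cap memv_pi.
Qed.

Fact quotv_vect_iso : Vector.axiom (\dim W^C) quotv.
Proof.
have [f f_lin f_bij] : Vector.axiom (\dim W^C) (subvs_of W^C).
  exact: subvs_vect_iso.
have toC_pi u : toC (repr (\pi_quotv u)) = toC u.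
  by apply/eqP; rewrite toC_eq repr_quotvB.
exists (fun x : quotv => f (toC (repr x))).
  move=> a; elim/quotW => u; elim/quotW => v.
  by rewrite -quotv_pi_linear !toC_pi /toC !linearP f_lin.
apply: bij_comp f_bij _; exists (fun y => \pi_quotv (vsval y)) => [x | y].
  elim/quotW: x => u; rewrite toC_pi; apply/eqP; rewrite quotv_eq -toC_eq.
  by rewrite /toC vsprojK ?memv_pi // daddv_pi_id ?capCW ?memv_pi.
by rewrite toC_pi /toC daddv_pi_id ?capCW ?subvsP // vsvalK.
Qed.

HB.instance Definition _ := Lmodule_hasFinDim.Build K quotv quotv_vect_iso.

HB.instance Definition _ :=
  GRing.isLinear.Build K vT quotv *:%R (\pi_quotv : vT -> quotv) quotv_pi_linear.

Definition quotv_proj : 'Hom(vT, quotv) := linfun (\pi_quotv : vT -> quotv).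

Lemma quotv_projE u : quotv_proj u = \pi_quotv u.
Proof. by rewrite lfunE. Qed.

Lemma lker_quotv_proj : lker quotv_proj = W.
Proof.
apply/vspaceP => u; rewrite memv_ker quotv_projE.
by rewrite -(linear0 (\pi_quotv : {linear vT -> quotv})) quotv_eq subr0.
Qed.

Lemma limg_quotv_proj : limg quotv_proj = fullv.
Proof.
apply/vspaceP => x; rewrite memvf; elim/quotW: x => u.
by rewrite -quotv_projE memv_img ?memvf.
Qed.

End QuotientSpace.

(* U / W is the image of U in the quotient space by W; it is the usual U / W  *)
(* when W <= U.                                                               *)
Notation "U / W" := (quotv_proj W @: U)%VS : vspace_scope.

Lemma dim_quotv (K : fieldType) (vT : vectType K) (U W : {vspace vT}) :
  (W <= U)%VS -> \dim (U / W) = (\dim U - \dim W)%N.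
Proof.
move=> sWU; rewrite -(limg_ker_dim (quotv_proj W) U) lker_quotv_proj.
by rewrite (capv_idPr sWU) addKn.
Qed.

(* {skew_symmetric P} is the type of skew-symmetric bilinear forms on P, over *)
(* which orthov is defined. An alternating form is always skew-symmetric.     *)
Section SubsystemCode.
Variables (K : fieldType) (P : vectType K) (omega : {skew_symmetric P}).
Implicit Types G alpha beta : {vspace P}.

Definition stabilizer G := (G :&: orthov omega G)%VS.

Definition gauge_dim G alpha :=
  \dim ((orthov omega (stabilizer G) :&: alpha + G) / G)%VS.

Definition bare_dim G beta :=
  \dim ((orthov omega G :&: beta + stabilizer G) / stabilizer G)%VS.

End SubsystemCode.

(* Main.v *)
(* With N := (S^_|_ :&: alpha) + G and B := (G^_|_ :&: alpha^_|_) + S, the    *)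
(* modular law (S <= G^_|_) gives B = (alpha^_|_ + S) :&: G^_|_ = N^_|_.      *)
(* Hence dim N + dim B = 2n, and subtracting dim G + dim S = 2n - 2k leaves   *)
(* 2k.                                                                        *)
Require Import Defs.
From mathcomp Require Import all_boot all_order all_algebra.
From mathcomp Require Import zify.
Set Implicit Arguments.
Unset Strict Implicit.

Import GRing.Theory.
Local Open Scope ring_scope.

(** For a nondegenerate form, orthogonality is an involution that complements dimensions and swaps
    sums with intersections ([dim_orthov], [orthovK], [orthov_capv]). It exchanges the numerators of
    the two quotients, and [g] cancels in the sum of the denominators' dimensions. *)

Section Orthogonal.
Variables (K : fieldType) (eps : bool) (theta : {rmorphism K -> K}).
Variables (vT : vectType K) (form : {hermitian vT for eps & theta}).
Implicit Types U V : {vspace vT}.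

Local Notation orthov := (orthov form).

Lemma orthov_addv U V : orthov (U + V) = (orthov U :&: orthov V)%VS.
Proof.
apply/eqP; rewrite eqEsubv subv_cap orthovD capvSl capvSr andbT.
by rewrite -orthovD subvv.
Qed.

Lemma sub_orthovK V : (V <= orthov (orthov V))%VS.
Proof. by rewrite orthov_sym subvv. Qed.

(** Each vector of a basis of [V] imposes one linear condition, lowering the dimension by at most
    one. *)
Lemma dim_orthov_ge V : (\dim {:vT} <= \dim V + \dim (orthov V))%N.
Proof.
suff dim_span (s : seq vT) : (\dim {:vT} <= size s + \dim (orthov <<s>>))%N.
  by have := dim_span (vbasis V); rewrite size_tuple (span_basis (vbasisP V)).
elim: s => [|u s IHs] /=; first by rewrite span_nil orthov0.
rewrite span_cons orthov_addv capvC addSn -addnS.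
apply: leq_trans IHs _; rewrite leq_add2l.
by have := leq_dim_orthov1 form u (orthov <<s>>); lia.
Qed.

Hypothesis form_nondegenerate : nondegenerate form.

Lemma dim_orthov V : (\dim V + \dim (orthov V))%N = \dim {:vT}.
Proof.
apply/eqP; rewrite eqn_leq dim_orthov_ge andbT.
(* V and its complement V^C span vT, so V^_|_ and (V^C)^_|_ are disjoint;    *)
(* the lower bound for (V^C)^_|_ thus becomes an upper bound for V^_|_.      *)
have disj : (orthov V :&: orthov V^C = 0)%VS.
  by rewrite -orthov_addv addv_complf; apply/eqP.
have := dimv_disjoint_sum disj.
have := dimvS (subvf (orthov V + orthov V^C)).
have := dim_orthov_ge V^C; have := dimv_compl V.
have := dimvS (subvf V); lia.
Qed.

Lemma orthovK V : orthov (orthov V) = V.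
Proof.
apply/esym/eqP; rewrite eqEdim sub_orthovK /=.
by rewrite -(leq_add2l (\dim (orthov V))) dim_orthov addnC dim_orthov.
Qed.

Lemma orthov_capv U V : orthov (U :&: V) = (orthov U + orthov V)%VS.
Proof. by rewrite -{1}[U]orthovK -{1}[V]orthovK -orthov_addv orthovK. Qed.

End Orthogonal.

Theorem proposition4p4 (K : fieldType) (P : vectType K) (n : nat)
    (omega : {skew_symmetric P})
    (omega_alternating : forall u : P, omega u u = 0)
    (omega_nondegenerate : nondegenerate omega)
    (dimP : \dim {:P} = (2 * n)%N)
    (G : {vspace P}) (k g : int)
    (dimG : (\dim G)%:Z = n%:Z - k + g)
    (dimS : (\dim (stabilizer omega G))%:Z = n%:Z - k - g)
    (alpha : {vspace P}) :
  (bare_dim omega G (orthov omega alpha))%:Z + (gauge_dim omega G alpha)%:Z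
    = 2 * k.
Proof.
rewrite /bare_dim /gauge_dim !dim_quotv ?addvSr //.
set S := stabilizer omega G in dimS *.
set N := (orthov omega S :&: alpha + G)%VS.
set B := (orthov omega G :&: orthov omega alpha + S)%VS.
have sSG' : (S <= orthov omega G)%VS by apply: capvSr.
have B_N' : B = orthov omega N.
  rewrite /N orthov_addv orthov_capv // orthovK //.
  by rewrite /B vspace_modr // capvC addvC.
have := dim_orthov omega_nondegenerate N.
(* These bounds make the truncated subtractions left by [dim_quotv] exact over the integers. *)
have : (\dim G <= \dim N)%N by apply/dimvS/addvSr.
have : (\dim S <= \dim B)%N by apply/dimvS/addvSr.
rewrite dimP -B_N'; lia.
Qed.
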